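(* Let $q$ be a prime power and $n\geq 12$ an integer. For an even integer $x$ let $$\begin{aligned}M(x)={}&q^{4(x-5)}+(q^{2x-10}+q^{2x-14})\big(q^{2x-14}+\tfrac{x-8}{2}q^{x-9}\big)+(q^{2x-11}+q^{2x-13})\big(\tfrac{x-8}{2}q^{x-10}+q^{2x-15}\big)\\&+(q^{2x-12}+q^{2x-13})\big(2q^{2x-16}+\tfrac{x-10}{2}q^{x-11}\big)\\&+(q^{2x-12}+q^{2x-14})\Big[\sum_{i=3}^{\min\{\lceil q/2\rceil+2,\lfloor (x-5)/2\rfloor\}}\big(iq^{2x-2i-12}+(\tfrac{x-6}{2}-i)q^{x-2i-7}\big)\\&\qquad+\sum_{i=2}^{\min\{\lfloor q/2\rfloor+2,\lceil (x-7)/2\rceil\}}\big(iq^{2x-2i-13}+(\tfrac{x-6}{2}-i)q^{x-2i-8}\big)\Big],\end{aligned}$$ and for an odd integer $x$ let $$\begin{aligned}M(x)={}&q^{4(x-5)}+(q^{2x-10}+q^{2x-14})\big(q^{2x-14}+\tfrac{x-9}{2}q^{x-8}+q^{\frac{x-9}{2}}\big)+(q^{2x-11}+q^{2x-13})\big(\tfrac{x-9}{2}q^{x-9}+q^{2x-15}+q^{x-8}\big)\\&+(q^{2x-12}+q^{2x-13})\big(q^{2x-16}+\tfrac{x-11}{2}q^{x-10}+q^{\frac{x-11}{2}}\big)\\&+(q^{2x-12}+q^{2x-14})\Big[\sum_{i=3}^{\min\{\lceil q/2\rceil+2,\lfloor (x-5)/2\rfloor\}}\big(iq^{2x-2i-12}+(\tfrac{x-7}{2}-i)q^{x-2i-6}+q^{\frac{x-7}{2}-i}\big)\\&\qquad+\sum_{i=2}^{\min\{\lfloor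 q/2\rfloor+2,\lceil (x-7)/2\rceil\}}\big(iq^{2x-2i-13}+(\tfrac{x-7}{2}-i)q^{x-2i-7}+q^{x-i-7}\big)\Big].\end{aligned}$$ Let $M_1=\sum_{j=0}^{\lfloor (n-12)/5\rfloor} M(n-5j)$. Then $$\bar A_q(n,4,5)\geq M_1+q^4+q^3+q^2+q+1.$$
   Context: $\mathcal G_q(n,k)$ is the set of $k$-dimensional subspaces of $\mathbb F_q^n$, with subspace distance $d_S(\mathcal U,\mathcal V)=\dim\mathcal U+\dim\mathcal V-2\dim(\mathcal U\cap\mathcal V)$; an $(n,d,k)_q$-CDC is a subset of $\mathcal G_q(n,k)$ with pairwise subspace distance at least $d$. An MRD$[k\times(n-k),\delta]_q$ code is an $\mathbb F_q$-linear subspace of $\mathbb F_q^{k\times(n-k)}$ of dimension $\max\{k,n-k\}(\min\{k,n-k\}-\delta+1)$ whose nonzero elements have rank at least $\delta$; a lifted MRD code is $\{\mathrm{rowspace}(\boldsymbol I_k\mid\boldsymbol A):\boldsymbol A\in\mathcal D\}$ for such $\mathcal D$. $\bar A_q(n,2\delta,k)$ is the maximum size of an $(n,2\delta,k)_q$-CDC containing a lifted MRD code as a subset (here $k=5$, $\delta=2$). *)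

(* Defs.v *)
From HB Require Import structures.
From mathcomp Require Import all_boot all_order all_algebra.

Set Implicit Arguments.
Unset Strict Implicit.
Unset Printing Implicit Defensive.

Import Order.TTheory GRing.Theory Num.Theory.

(* Subspaces of a vector space over a finite field form a finite type, which
   makes it possible to speak of finite sets of subspaces and of maxima over
   them. *)
Section FiniteSubspaces.

Import VectorInternalTheory.

HB.instance Definition _ (F : finFieldType) (vT : vectType F) :=
  [Countable of {vspace vT} by <:].
HB.instance Definition _ (F : finFieldType) (vT : vectType F) :=
  [Finite of {vspace vT} by <:].

End FiniteSubspaces.

Section SubspaceCodes.

Variable F : finFieldType.

Definition grassmannian (n k : nat) : {set {vspace 'rV[F]_n}} :=
  [set U | \dim U == k].

(* The natural-number subtraction never truncates, since U :&: V is contained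
   in both U and V. *)
Definition subspace_dist n (U V : {vspace 'rV[F]_n}) : nat :=
  \dim U + \dim V - 2 * \dim (U :&: V)%VS.

Definition is_CDC (n d k : nat) (C : {set {vspace 'rV[F]_n}}) : bool :=
  (C \subset grassmannian n k)
  && [forall U in C, forall V in C, (U != V) ==> (d <= subspace_dist U V)].

(* The dimension is max(a, b) * (min(a, b) - delta + 1); the grouping avoids
   truncated subtraction when delta = min(a, b) + 1. *)
Definition is_MRD (a b delta : nat) (D : {vspace 'M[F]_(a, b)}) : bool :=
  (\dim D == maxn a b * ((minn a b).+1 - delta))
  && [forall A : 'M[F]_(a, b),
        (A \in D) ==> (A != 0%R) ==> (delta <= \rank A)].

Definition rowspace k n (A : 'M[F]_(k, n)) : {vspace 'rV[F]_n} :=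
  <<[seq row i A | i <- enum 'I_k]>>%VS.

(* row_mx 1%:M A has k + (n - k) columns; conform_mx retypes it as a matrix
   with n columns, and its default value 0 is never used when k <= n. *)
Definition lift_mx n k (A : 'M[F]_(k, n - k)) : {vspace 'rV[F]_n} :=
  rowspace (conform_mx (0%R : 'M[F]_(k, n)) (row_mx 1%:M%R A)).

Definition lifted_code n k (D : {vspace 'M[F]_(k, n - k)}) :
    {set {vspace 'rV[F]_n}} :=
  [set lift_mx A | A : 'M[F]_(k, n - k) in D].

Definition contains_LMRD n k delta (C : {set {vspace 'rV[F]_n}}) : bool :=
  [exists D : {vspace 'M[F]_(k, n - k)},
     is_MRD delta D && (lifted_code D \subset C)].

(* The minimum subspace distance d is meant to be even, d = 2 * delta. *)
Definition Abar (n d k : nat) : nat :=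
  \max_(C : {set {vspace 'rV[F]_n}}
         | is_CDC d k C && contains_LMRD k d./2 C) #|C|.

End SubspaceCodes.

Local Open Scope ring_scope.

(* The values live in rat and the exponents in int: at the last index of the
   inner sums some powers of q have a negative exponent (for instance
   - q^-1 + q^-1 when x is odd and i = (x - 5) / 2), so natural-number
   arithmetic would give wrong values. The halves taken in exponents are
   exact because x is odd there. *)
Definition M_even (q x : nat) : rat :=
  let Q : rat := q%:R in
  let X : int := x%:Z in
  let r : rat := x%:R in
    Q ^ (4 * (X - 5))
  + (Q ^ (2 * X - 10) + Q ^ (2 * X - 14))
      * (Q ^ (2 * X - 14) + (r - 8) / 2 * Q ^ (X - 9))
  + (Q ^ (2 * X - 11) + Q ^ (2 * X - 13))
      * ((r - 8) / 2 * Q ^ (X - 10) + Q ^ (2 * X - 15))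
  + (Q ^ (2 * X - 12) + Q ^ (2 * X - 13))
      * (2 * Q ^ (2 * X - 16) + (r - 10) / 2 * Q ^ (X - 11))
  + (Q ^ (2 * X - 12) + Q ^ (2 * X - 14))
      * (\sum_(3 <= i < (minn (uphalf q + 2) (x - 5)./2).+1)
           (i%:R * Q ^ (2 * X - 2 * i%:Z - 12)
            + ((r - 6) / 2 - i%:R) * Q ^ (X - 2 * i%:Z - 7))
         + \sum_(2 <= i < (minn (q./2 + 2) (uphalf (x - 7))).+1)
           (i%:R * Q ^ (2 * X - 2 * i%:Z - 13)
            + ((r - 6) / 2 - i%:R) * Q ^ (X - 2 * i%:Z - 8))).

Definition M_odd (q x : nat) : rat :=
  let Q : rat := q%:R in
  let X : int := x%:Z in
  let r : rat := x%:R in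
    Q ^ (4 * (X - 5))
  + (Q ^ (2 * X - 10) + Q ^ (2 * X - 14))
      * (Q ^ (2 * X - 14) + (r - 9) / 2 * Q ^ (X - 8)
         + Q ^ ((X - 9) %/ 2)%Z)
  + (Q ^ (2 * X - 11) + Q ^ (2 * X - 13))
      * ((r - 9) / 2 * Q ^ (X - 9) + Q ^ (2 * X - 15) + Q ^ (X - 8))
  + (Q ^ (2 * X - 12) + Q ^ (2 * X - 13))
      * (Q ^ (2 * X - 16) + (r - 11) / 2 * Q ^ (X - 10)
         + Q ^ ((X - 11) %/ 2)%Z)
  + (Q ^ (2 * X - 12) + Q ^ (2 * X - 14))
      * (\sum_(3 <= i < (minn (uphalf q + 2) (x - 5)./2).+1)
           (i%:R * Q ^ (2 * X - 2 * i%:Z - 12)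
            + ((r - 7) / 2 - i%:R) * Q ^ (X - 2 * i%:Z - 6)
            + Q ^ (((X - 7) %/ 2)%Z - i%:Z))
         + \sum_(2 <= i < (minn (q./2 + 2) (uphalf (x - 7))).+1)
           (i%:R * Q ^ (2 * X - 2 * i%:Z - 13)
            + ((r - 7) / 2 - i%:R) * Q ^ (X - 2 * i%:Z - 7)
            + Q ^ (X - i%:Z - 7))).

Definition M_term (q x : nat) : rat := if odd x then M_odd q x else M_even q x.

Definition M_1 (q n : nat) : rat :=
  \sum_(0 <= j < ((n - 12) %/ 5).+1) M_term q (n - 5 * j).

(* Main.v *)
(* Echelon-Ferrers construction. A subspace in reduced echelon form has a set
   of pivot columns, and two subspaces of dimension 5 whose pivot sets share at
   most three columns meet in dimension at most 3, as every nonzero vector of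
   the intersection has its leading coordinate in a common pivot column. For a
   fixed pivot set the free entries form a Ferrers diagram; requiring
   sum_(i,j) X i j * (u i * v j) = 0 in a field extension, with independent u
   and independent v, excludes differences of rank one and costs only as many
   dimensions as there are free columns. The pivot set {0, ..., 4} gives the
   lifted MRD code. Adding the twelve pivot sets {0} + e + f, where e and f are
   edges in corresponding perfect matchings of two 1-factorized copies of K_4,
   on {1, ..., 4} and on {5, ..., 8}, yields, with m = x - 5,
     q^(4m) + q^(4m-4) + q^(4m-6) + 8 q^(4m-8) + q^(4m-10) + q^(4m-12) >= M(x)
   codewords. Shifting everything by multiples of 5 columns gives the sum M_1,
   and a last shifted copy of {0, ..., 4} contributes q^5 more codewords. *)
From HB Require Import structures.
Require Import Defs.
From mathcomp Require Import all_boot all_order all_algebra.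
From mathcomp Require Import all_fingroup all_field.
From mathcomp Require Import zify ring lra.

Set Implicit Arguments.
Unset Strict Implicit.
Unset Printing Implicit Defensive.

Import Order.TTheory GRing.Theory Num.Theory.
Local Open Scope ring_scope.

(** * Field extensions and the rank-one-free pairing *)

(** [L] is a splitting field of ['X^m - 'X] with [m = #|F| ^ d]. The roots form the fixed field of
    the [d]-th power of Frobenius, hence all of [L], and by separability there are exactly [m] of
    them. *)
Lemma fieldExt_of_degree (F : finFieldType) (d : nat) :
  (0 < d)%N -> exists L : fieldExtType F, \dim {:L} = d.
Proof.
move=> d_gt0; have F_gt1 : (1 < #|F|)%N := finNzRing_gt1 F.
set m := (#|F| ^ d)%N; have m_gt1 : (1 < m)%N by rewrite (ltn_exp2l 0).
have m1_gt0 : (0 < m.-1)%N by rewrite -ltnS prednK // ltnW.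
pose p (R : nzRingType) : {poly R} := 'X^m - 'X.
have Dp R : p R = ('X^(m.-1) - 1) * ('X - 0).
  by rewrite subr0 mulrBl mul1r -exprSr prednK // ltnW.
have /FinSplittingFieldFor[/= L] : p F != 0.
  by rewrite Dp monic_neq0 ?rpredM ?monicXsubC ?monicXnsubC.
rewrite rmorphB rmorphXn /= map_polyX -/(p L) => -[zs DpL defL].
exists L; pose Fm := FinFieldExtType L.
have m0 : m%:R = 0 :> L.
  suff F0 : #|F|%:R = 0 :> F.
    by rewrite -(rmorph_nat (in_alg L)) /m natrX F0 expr0n gtn_eqF ?rmorph0.
  (* Translation by 1 permutes [F], so adding [#|F|] does not change the sum of all elements. *)
  apply: (addrI (\sum_(x : F) x)).
  rewrite addr0 [RHS](reindex_inj (addIr 1)) big_split /=.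
  by rewrite sumr_const.
have /finField_galois_generator[/= a _ Da] : (1 <= {:L})%VS by apply: sub1v.
rewrite dimv1 expn1 in Da; pose Em := fixedSpace (a ^+ d)%g.
have Uzs : uniq zs.
  rewrite -separable_prod_XsubC -(eqp_separable DpL) Dp separable_root andbC.
  rewrite /root !hornerE subr_eq0 eq_sym expr0n gtn_eqF ?oner_eq0 //=.
  rewrite cyclotomic.separable_Xn_sub_1 // -subn1 natrB ?(ltnW m_gt1) // subr_eq0.
  by rewrite m0 eq_sym oner_eq0.
have in_zs : zs =i Em.
  move=> z; rewrite -root_prod_XsubC -(eqp_root DpL) (sameP fixedSpaceP eqP).
  rewrite /root !hornerE subr_eq0 /= /m; congr (_ == z).
  elim: (d) => [|i IHi]; first by rewrite gal_id.
  by rewrite expgSr expnSr exprM IHi galM ?Da ?memvf.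
have defEm : Em = {:L}%VS.
  apply/eqP; rewrite eqEsubv subvf -defL -[Em]subfield_closed agenvS //.
  by rewrite subv_add sub1v; apply/span_subvP=> z; rewrite in_zs.
have /eq_card cardL : Fm =i zs by move=> z; rewrite in_zs defEm memvf.
apply/eqP; rewrite -(eqn_exp2l _ _ F_gt1); apply/eqP.
have -> : (#|F| ^ \dim {:L})%N = #|Fm|.
  rewrite -(@card_vspace F Fm (Vector.class (L : vectType F)) {:L}).
  by apply: eq_card => z; rewrite [LHS]memvf.
rewrite cardL (card_uniqP _) //; apply: succn_inj.
rewrite -(size_prod_XsubC _ id) -(eqp_size DpL).
by rewrite size_polyDl size_polyXn // size_polyN size_polyX.
Qed.

Lemma independent_family (K : fieldType) (V : vectType K) (T : finType)
    (A : {set T}) :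
  (#|A| <= \dim {:V})%N ->
  exists v : T -> V, forall w : T -> K,
    \sum_(j in A) w j *: v j = 0 -> {in A, forall j, w j = 0}.
Proof.
move=> leAV; pose e := vbasis {:V}.
exists (fun j => e`_(index j (enum A))) => w sum0 j0 Aj0.
have ltA j : j \in A -> (index j (enum A) < \dim {:V})%N.
  by move=> Aj; apply: leq_trans leAV; rewrite cardE index_mem mem_enum.
have coord_e j : j \in A ->
    coord e (Ordinal (ltA j0 Aj0)) e`_(index j (enum A)) = (j == j0)%:R.
  move=> Aj; have /= := coord_free (Ordinal (ltA j Aj)) (Ordinal (ltA j0 Aj0)).
  move=> ->; last exact: basis_free (vbasisP _).
  rewrite -val_eqE /=; congr (_%:R); congr nat_of_bool.
  apply/eqP/eqP=> [|-> //].
  by apply: (index_inj j); rewrite mem_enum.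
have := congr1 (coord e (Ordinal (ltA j0 Aj0))) sum0.
rewrite linear0 linear_sum (bigD1 j0) //= linearZ /= coord_e // eqxx.
rewrite big1 ?addr0 => [|j /andP[Aj /negPf jj0]].
  by rewrite /GRing.scale /= mulr1.
by rewrite linearZ /= coord_e // jj0 /GRing.scale /= mulr0.
Qed.

(* Multiplication in a field extension has no zero divisors: taking for
   [h i j] the products of two independent families of its elements gives a
   linear map that kills no nonzero matrix of rank one. *)
Lemma rank_one_free_pairing (F : finFieldType) (k : nat) (T : finType)
    (A : {set T}) :
  (0 < k)%N ->
  exists (L : vectType F) (h : 'I_k -> T -> L),
    \dim {:L} = maxn k #|A| /\
    forall (a : 'I_k -> F) (w : T -> F),
      \sum_i \sum_(j in A) (a i * w j) *: h i j = 0 ->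
      (forall i, a i = 0) \/ {in A, forall j, w j = 0}.
Proof.
move=> k_gt0; have d_gt0 : (0 < maxn k #|A|)%N by rewrite leq_max k_gt0.
have [L dimL] := fieldExt_of_degree F d_gt0.
have [|u uP] := @independent_family F L 'I_k setT.
  by rewrite cardsT card_ord dimL leq_maxl.
have [|v vP] := @independent_family F L T A; first by rewrite dimL leq_maxr.
exists L, (fun i j => u i * v j); split=> // a w.
have -> : \sum_i \sum_(j in A) (a i * w j) *: (u i * v j)
          = (\sum_(i in setT) a i *: u i) * (\sum_(j in A) w j *: v j).
  rewrite mulr_suml; apply: eq_big => [i|i _]; rewrite ?inE // mulr_sumr.
  by apply: eq_bigr => j _; rewrite -scalerAl -scalerAr scalerA.
move/eqP; rewrite mulf_eq0 => /orP[] /eqP sum0; [left=> i | right].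
  by apply: uP sum0 _ _; rewrite inE.
exact: vP.
Qed.

(** * Echelon forms and pivots *)

Section EchelonForms.

Variables (F : finFieldType) (k n : nat).

Lemma mxrank_le1 (X : 'M[F]_(k, n)) :
  (\rank X <= 1)%N -> exists (a : 'cV[F]_k) (w : 'rV[F]_n), X = a *m w.
Proof.
move=> rX; have [X0|/rowV0Pn[w wX w_nz]] := eqVneq X 0.
  by exists 0, 0; rewrite X0 mul0mx.
have : (X <= w)%MS.
  rewrite -(geq_leqif (mxrank_leqif_sup wX)).
  by apply: leq_trans rX _; rewrite lt0n mxrank_eq0.
by case/submxP=> a ->; exists a, w.
Qed.

Definition rowmul (A : 'M[F]_(k, n)) : 'Hom('rV[F]_k, 'rV[F]_n) :=
  linfun (mulmxr A).

Lemma rowmulE (A : 'M[F]_(k, n)) (x : 'rV[F]_k) : rowmul A x = x *m A.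
Proof. exact: lfunE. Qed.

Lemma mem_rowspace (A : 'M[F]_(k, n)) (v : 'rV[F]_n) :
  (v \in rowspace A) -> exists x : 'rV[F]_k, v = x *m A.
Proof.
rewrite /rowspace => vA.
suff /subvP/(_ v vA) : (rowspace A <= limg (rowmul A))%VS.
  by case/memv_imgP=> x _ ->; exists x; rewrite rowmulE.
apply/span_subvP => _ /mapP[i _ ->].
by rewrite rowE -rowmulE memv_img ?memvf.
Qed.

Lemma rowspace_mulmx (A : 'M[F]_(k, n)) (x : 'rV[F]_k) :
  x *m A \in rowspace A.
Proof.
rewrite mulmx_sum_row; apply: rpred_sum => i _; apply: rpredZ.
by apply/memv_span/mapP; exists i; rewrite ?mem_enum.
Qed.

Lemma dim_rowspace_inj (A : 'M[F]_(k, n)) :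
  (forall x : 'rV[F]_k, x *m A = 0 -> x = 0) -> \dim (rowspace A) = k.
Proof.
move=> injA; have -> : rowspace A = limg (rowmul A).
  apply/eqP; rewrite eqEsubv; apply/andP; split; apply/subvP=> v.
    by case/mem_rowspace=> x ->; rewrite -rowmulE memv_img ?memvf.
  by case/memv_imgP=> x _ ->; rewrite rowmulE rowspace_mulmx.
rewrite limg_dim_eq ?dimvf /dim /= ?mul1n //.
apply/eqP; rewrite -subv0; apply/subvP=> x.
by rewrite memv_cap memv_ker rowmulE memv0 => /andP[_ /eqP/injA->].
Qed.

(** Rank-nullity: the image has dimension at least two, since an image inside a line [<[w]>] would
    make [X] a column times [w]. *)
Lemma dim_lker_mulmxr (X : 'M[F]_(k, n)) :
  (1 < \rank X)%N -> (\dim (lker (rowmul X)) + 2 <= k)%N.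
Proof.
move=> rX; have := limg_ker_dim (rowmul X) fullv.
rewrite capfv dimvf /dim /= mul1n => dimK.
rewrite -[X in (_ <= X)%N]dimK leq_add2l ltnNge.
apply: contraL rX => img1; rewrite -leqNgt.
suff [w imgw] : exists w, (limg (rowmul X) <= <[w]>)%VS.
  have -> : X = (\col_i coord [tuple w] 0 (row i X)) *m w.
    apply/row_matrixP=> i.
    have : row i X \in <<[tuple w]>>%VS.
      rewrite span_seq1; apply: (subvP imgw).
      by rewrite rowE -rowmulE memv_img ?memvf.
    move/coord_span => E; rewrite {1}E big_ord1 /=.
    by apply/rowP=> j; rewrite !mxE big_ord1 !mxE.
  exact: mulmx_max_rank.
have [->|nz] := eqVneq (limg (rowmul X)) 0%VS.
  by exists 0; apply: sub0v.
exists (vpick (limg (rowmul X))).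
have sub : (<[vpick (limg (rowmul X))]> <= limg (rowmul X))%VS.
  exact: memv_pick.
rewrite -(geq_leqif (dimv_leqif_sup sub)); apply: leq_trans img1 _.
by rewrite dim_vline vpick0 nz.
Qed.

(* The echelon form with pivot columns [s] is [pivot_mx s + X], where [X] is
   supported on the free cells [dots s] (the Ferrers diagram of [s]). *)
Definition pivot_mx (s : seq nat) : 'M[F]_(k, n) :=
  \matrix_(i, j) (val j == nth 0%N s i)%:R.

Definition dots (s : seq nat) : {set 'I_k * 'I_n} :=
  [set ij : 'I_k * 'I_n | (nth 0%N s ij.1 < ij.2)%N && (val ij.2 \notin s)].

Definition supported (s : seq nat) (X : 'M[F]_(k, n)) : Prop :=
  forall i j, (i, j) \notin dots s -> X i j = 0.

Definition leads_in (s : seq nat) (U : {vspace 'rV[F]_n}) : Prop :=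
  forall v, v \in U -> v != 0 ->
    exists j : 'I_n, [/\ val j \in s, v 0 j != 0
                       & forall j' : 'I_n, (j' < j)%N -> v 0 j' = 0].

Definition pivots (s : seq nat) : Prop :=
  [/\ size s = k, sorted ltn s & all (fun c => c < n)%N s].

(** * Subspaces with a fixed pivot set *)

Section Pivots.

Variable s : seq nat.
Hypothesis pivots_s : pivots s.

Lemma pivot_lt (i : 'I_k) : (nth 0%N s i < n)%N.
Proof. by case: pivots_s => ss _ /all_nthP; apply; rewrite ss. Qed.

Definition pivot_col (i : 'I_k) : 'I_n := Ordinal (pivot_lt i).

Lemma pivot_nth_lt (i i' : 'I_k) : (nth 0%N s i < nth 0%N s i')%N = (i < i')%N.
Proof.
case: pivots_s => ss srt _.
have mono (a b : 'I_k) : (a < b)%N -> (nth 0%N s a < nth 0%N s b)%N.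
  by apply: (sorted_ltn_nth ltn_trans 0%N srt); rewrite inE ss.
case: (ltngtP i i') => [/mono // | /mono lt | /val_inj->]; last exact: ltnn.
by apply/negbTE; rewrite -leqNgt ltnW.
Qed.

(** No dot lies in a pivot column, so the pivot columns form an identity matrix and the coefficients
    of a vector of the row space can be read off there. *)
Lemma pivot_coord (X : 'M[F]_(k, n)) (x : 'rV[F]_k) (i : 'I_k) :
  supported s X -> (x *m (pivot_mx s + X)) 0 (pivot_col i) = x 0 i.
Proof.
case: pivots_s => ss srt _ supX.
rewrite mxE (bigD1 i) //= big1 => [|i' i'i].
  rewrite !mxE eqxx supX ?addr0 ?mulr1 //.
  by rewrite inE /= mem_nth ?ss ?ltn_ord // andbF.
rewrite !mxE supX /= ?addr0; last by rewrite inE /= mem_nth ?ss ?ltn_ord // andbF.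
rewrite nth_uniq ?ss ?ltn_ord ?(sorted_uniq ltn_trans ltnn) //.
by rewrite val_eqE eq_sym (negPf i'i) mulr0.
Qed.

Lemma pivot_mulmx_inj (X : 'M[F]_(k, n)) (x : 'rV[F]_k) :
  supported s X -> x *m (pivot_mx s + X) = 0 -> x = 0.
Proof.
move=> supX x0; apply/rowP=> i.
by rewrite -(pivot_coord _ _ supX) x0 !mxE.
Qed.

Lemma dim_rowspace_pivot (X : 'M[F]_(k, n)) :
  supported s X -> \dim (rowspace (pivot_mx s + X)) = k.
Proof.
by move=> supX; apply: dim_rowspace_inj => x; apply: pivot_mulmx_inj.
Qed.

(** The leading coordinate is the pivot of the least [i] with [x 0 i != 0]: each row vanishes to the
    left of its pivot, and the pivots increase. *)
Lemma leads_in_rowspace (X : 'M[F]_(k, n)) :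
  supported s X -> leads_in s (rowspace (pivot_mx s + X)).
Proof.
move=> supX v /mem_rowspace[x ->] xG_nz.
have [i0 xi0] : exists i, x 0 i != 0.
  apply/existsP; apply: contraNT xG_nz => /existsPn x0.
  have -> : x = 0.
    by apply/rowP=> i; rewrite mxE; apply/eqP; have := x0 i; rewrite negbK.
  by rewrite mul0mx.
case: (arg_minnP (P := fun i => x 0 i != 0) (fun i : 'I_k => val i) xi0) => i xi min_i.
have [ss _ _] := pivots_s.
exists (pivot_col i); rewrite pivot_coord //; split=> //=.
  by rewrite mem_nth ?ss.
move=> j ltj; rewrite mxE big1 // => i' _.
have [->|/min_i] := eqVneq (x 0 i') 0; first by rewrite mul0r.
move=> le_ii'; have lt_j : (j < nth 0%N s i')%N.
  by apply: leq_trans ltj _; rewrite leqNgt pivot_nth_lt -leqNgt.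
rewrite !mxE ltn_eqF // add0r supX ?mulr0 //.
by rewrite inE /= ltnNge ltnW.
Qed.

(** The pivot coordinates of a common vector force the same coefficient vector [x] in both row
    spaces, so [x] lies in the kernel of [X - Y], of dimension at most [k - 2]. *)
Lemma dim_cap_same_pivots (X Y : 'M[F]_(k, n)) :
  supported s X -> supported s Y -> (1 < \rank (X - Y)%R)%N ->
  (\dim (rowspace (pivot_mx s + X)%R :&:
         rowspace (pivot_mx s + Y)%R)%VS + 2
     <= k)%N.
Proof.
move=> supX supY /dim_lker_mulmxr; apply: leq_trans; rewrite leq_add2r.
set K := lker _; apply: (@leq_trans (\dim (rowmul (pivot_mx s + X)%R @: K)%VS)).
  apply: dimvS; apply/subvP=> v; rewrite memv_cap => /andP[].
  case/mem_rowspace=> x -> /mem_rowspace[y xy].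
  have exy : x = y.
    by apply/rowP=> i; rewrite -(pivot_coord _ _ supX) xy pivot_coord.
  rewrite -rowmulE memv_img // memv_ker rowmulE.
  by rewrite mulmxBr subr_eq0 -(inj_eq (addrI (x *m pivot_mx s))) -!mulmxDr {2}exy xy.
by rewrite -(limg_ker_dim (rowmul (pivot_mx s + X)) K) leq_addl.
Qed.

End Pivots.

(** Projection to the coordinates in both [s] and [s'] is injective on the intersection: the leading
    coordinate of a nonzero vector is unique, hence in both lists. *)
Lemma dim_cap_leads_in (s s' : seq nat) (U V : {vspace 'rV[F]_n}) :
  leads_in s U -> leads_in s' V ->
  (\dim (U :&: V)%VS <= size [seq c <- s | c \in s'])%N.
Proof.
move=> leadU leadV.
pose K := [set j : 'I_n | (val j \in s) && (val j \in s')].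
apply: (@leq_trans #|K|); last first.
  rewrite cardE -(size_map val); apply: uniq_leq_size.
    by rewrite map_inj_uniq ?enum_uniq //; apply: val_inj.
  move=> c /mapP[j]; rewrite mem_enum inE => /andP[js js'] ->.
  by rewrite mem_filter js'.
pose pr (v : 'rV[F]_n) : 'rV[F]_#|K| := colsub (fun t : 'I_#|K| => enum_val t) v.
pose f := linfun (pr : {linear 'rV[F]_n -> 'rV[F]_#|K|}).
rewrite -(@limg_dim_eq _ _ _ f (U :&: V)%VS).
  apply: leq_trans (dimvS (subvf _)) _.
  by rewrite dimvf /dim /= mul1n.
apply/eqP; rewrite -subv0; apply/subvP=> v.
rewrite memv_cap memv_ker lfunE memv0 => /andP[/[!memv_cap]/andP[vU vV]].
apply: contraLR => v_nz.
have [j [js vj0 j_min]] := leadU v vU v_nz.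
have [j' [js' vj'0 j'_min]] := leadV v vV v_nz.
have jj' : j = j'.
  have [/j'_min vj|/j_min vj'|/val_inj //] := ltngtP j j'.
    by rewrite vj eqxx in vj0.
  by rewrite vj' eqxx in vj'0.
have jK : j \in K by rewrite inE js jj' js'.
apply: contraNneq vj0 => /rowP/(_ (enum_rank_in jK j)).
by rewrite !mxE enum_rankK_in // => ->.
Qed.

End EchelonForms.

(** * Rank-metric codes on Ferrers diagrams *)

Lemma dim_lker_ge (K : fieldType) (U V : vectType K) (f : 'Hom(U, V)) :
  (\dim {:U} <= \dim (lker f) + \dim {:V})%N.
Proof.
rewrite -(limg_ker_dim f fullv) capfv leq_add2l.
exact: dimvS (subvf _).
Qed.

Lemma subspace_of_dim (K : fieldType) (V : vectType K) (U : {vspace V}) (d : nat) :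
  (d <= \dim U)%N -> exists W : {vspace V}, (W <= U)%VS /\ \dim W = d.
Proof.
move=> ledU; exists <<take d (vbasis U)>>%VS; split.
  by apply/span_subvP=> v /mem_take /vbasis_mem.
have /eqP -> : free (take d (vbasis U)).
  have := basis_free (vbasisP U); rewrite -{1}(cat_take_drop d (vbasis U)).
  exact: catl_free.
by rewrite size_takel ?size_tuple.
Qed.

Section FerrersCodes.

Variables (F : finFieldType) (k n : nat).

Section Syndrome.

Variables (L : vectType F) (A : {set 'I_n}) (h : 'I_k -> 'I_n -> L).

Definition syndrome (X : 'M[F]_(k, n)) : L :=
  \sum_i \sum_(j in A) X i j *: h i j.

Fact syndrome_is_linear : linear syndrome.
Proof.
move=> c X Y; rewrite /syndrome scaler_sumr -big_split; apply: eq_bigr => i _ /=.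
rewrite scaler_sumr -big_split; apply: eq_bigr => j _ /=.
by rewrite !mxE scalerDl scalerA.
Qed.

HB.instance Definition _ :=
  GRing.isLinear.Build F 'M[F]_(k, n) L *:%R syndrome syndrome_is_linear.

(** A matrix of rank at most one is a product [a *m w], and its syndrome is the pairing of [a] with
    [w], which vanishes only if [a] or the part of [w] on [A] does. *)
Lemma syndrome_rank (X : 'M[F]_(k, n)) :
  (forall (a : 'I_k -> F) (w : 'I_n -> F),
      \sum_i \sum_(j in A) (a i * w j) *: h i j = 0 ->
      (forall i, a i = 0) \/ {in A, forall j, w j = 0}) ->
  (forall i j, j \notin A -> X i j = 0) ->
  syndrome X = 0 -> X != 0 -> (1 < \rank X)%N.
Proof.
move=> hP supX synX; apply: contraNT; rewrite -leqNgt => /mxrank_le1[a [w EX]].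
have EXij i j : X i j = a i 0 * w 0 j by rewrite EX mxE big_ord1.
case: (hP (fun i => a i 0) (fun j => w 0 j)) => [|a0|w0].
- rewrite -[RHS]synX; apply: eq_bigr => i _; apply: eq_bigr => j _.
  by rewrite EXij.
- by apply/eqP/matrixP=> i j; rewrite EXij a0 mul0r mxE.
apply/eqP/matrixP=> i j; rewrite [RHS]mxE.
by have [/w0 wj|/supX->//] := boolP (j \in A); rewrite EXij wj mulr0.
Qed.

End Syndrome.

Definition undotted (s : seq nat) (X : 'M[F]_(k, n)) : 'rV[F]_#|~: dots k n s| :=
  \row_t X (enum_val t).1 (enum_val t).2.

Fact undotted_is_linear s : linear (undotted s).
Proof. by move=> c X Y; apply/rowP=> t; rewrite !mxE. Qed.

HB.instance Definition _ s :=
  GRing.isLinear.Build F 'M[F]_(k, n) 'rV[F]_#|~: dots k n s| *:%R (undotted s)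
    (undotted_is_linear s).

(** The columns of the dots in the top row; as pivots increase, they include every column that
    contains a dot. *)
Definition free_cols (s : seq nat) : {set 'I_n} :=
  [set j : 'I_n | (nth 0%N s 0 < j)%N && (val j \notin s)].

(** The code is an intersection of two kernels: the support condition costs at most one dimension
    per cell outside the diagram, the syndrome at most [maxn k #|free_cols s|]. *)
Lemma ferrers_code (s : seq nat) : (0 < k)%N -> pivots k n s ->
  exists D : {vspace 'M[F]_(k, n)},
    [/\ {in D, forall X, supported s X},
        {in D, forall X, X != 0 -> (1 < \rank X)%N}
      & (#|dots k n s| - maxn k #|free_cols s| <= \dim D)%N].
Proof.
move=> k_gt0 pivots_s.
have [L [h [dimL hP]]] := rank_one_free_pairing F (free_cols s) k_gt0.
pose synd := linfun (syndrome (free_cols s) h).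
pose und := linfun (undotted s).
have supD X : X \in lker und -> supported s X.
  rewrite memv_ker lfunE => /eqP/rowP X0 i j ij.
  have ij' : (i, j) \in ~: dots k n s by rewrite inE.
  have := X0 (enum_rank_in ij' (i, j)).
  by rewrite !mxE enum_rankK_in.
exists (lker synd :&: lker und)%VS; split=> [X|X|].
- by rewrite memv_cap => /andP[_]; apply: supD.
- rewrite memv_cap memv_ker lfunE => /andP[/eqP synX /supD supX].
  apply: (syndrome_rank hP) synX => i j; rewrite inE => jA; apply: supX.
  apply: contra jA; rewrite inE /= => /andP[lt_ij ->]; rewrite andbT.
  apply: leq_ltn_trans lt_ij.
  case: (posnP i) => [-> //|i_gt0]; apply: ltnW.
  have := pivot_nth_lt pivots_s (Ordinal k_gt0) i.
  by rewrite /= i_gt0.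
have := dimv_sum_cap (lker synd) (lker und).
have := dimvS (subvf (lker synd + lker und)%VS).
have := dim_lker_ge synd; have := dim_lker_ge und.
rewrite dimL !dimvf /dim /= mul1n.
have := cardsC (dots k n s); rewrite card_prod !card_ord.
move: (\dim (lker synd)) (\dim (lker und)) => dS dU.
move: (\dim (_ + _)) (\dim (_ :&: _)) => dA dC.
move: #|dots _ _ _| #|~: _| #|free_cols _|; lia.
Qed.

End FerrersCodes.

(** The kernel of the syndrome over all columns has dimension at least [k * m - maxn k m], the MRD
    value; a subspace of it has exactly the prescribed dimension. *)
Lemma MRD_exists (F : finFieldType) (k m : nat) : (0 < k)%N ->
  exists D : {vspace 'M[F]_(k, m)}, is_MRD 2 D.
Proof.
move=> k_gt0.
have [L [h [dimL hP]]] := rank_one_free_pairing F [set: 'I_m] k_gt0.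
have [|D [subD dimD]] := @subspace_of_dim F 'M[F]_(k, m)
    (lker (linfun (syndrome setT h))) (maxn k m * ((minn k m).+1 - 2)).
  have := dim_lker_ge (linfun (syndrome setT h)).
  rewrite dimL !dimvf /dim /= cardsT card_ord.
  move: (\dim (lker _)) => dK le_dK; rewrite leqNgt; apply/negP.
  by rewrite /maxn /minn in le_dK *; case: ltnP le_dK; nia.
exists D; apply/andP; split; first by rewrite dimD.
apply/forallP=> X; apply/implyP=> /(subvP subD); rewrite memv_ker lfunE => /eqP.
move=> synX; apply/implyP; apply: (syndrome_rank hP) synX.
by move=> i j; rewrite inE.
Qed.

(** * Subspace codes from echelon forms *)

Lemma card_set_vspace (F : finFieldType) (k n : nat) (D : {vspace 'M[F]_(k, n)}) :
  #|[set X in D]| = (#|F| ^ \dim D)%N.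
Proof. by rewrite cardsE; apply: card_vspace. Qed.

Section EchelonCodes.

Variables (F : finFieldType) (k n : nat).

(** The last clause says that the subspace distance is at least 4, without subtraction. *)
Definition echelon_code (s : seq nat) (C : {set {vspace 'rV[F]_n}}) : Prop :=
  [/\ {in C, forall U, \dim U = k}, {in C, forall U, leads_in s U}
    & {in C &, forall U V, U != V -> (\dim (U :&: V)%VS + 2 <= k)%N}].

Lemma echelon_code_of_matrices (s : seq nat) (D : {set 'M[F]_(k, n)}) :
  pivots k n s -> {in D, forall X, supported s X} ->
  {in D &, forall X Y, X != Y -> (1 < \rank (X - Y)%R)%N} ->
  let C := [set rowspace (pivot_mx F k n s + X) | X in D] in
  echelon_code s C /\ #|C| = #|D|.
Proof.
move=> pivots_s supD rankD C; split; last first.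
  apply: card_in_imset => X Y DX DY eqXY; apply: contraTeq isT => neqXY.
  have := dim_cap_same_pivots pivots_s (supD _ DX) (supD _ DY) (rankD _ _ DX DY neqXY).
  rewrite eqXY capvv dim_rowspace_pivot //; last exact: supD.
  by rewrite -[X in (_ <= X)%N]addn0 leq_add2l.
split=> [_ /imsetP[X DX ->]|_ /imsetP[X DX ->]|].
- exact: (dim_rowspace_pivot pivots_s (supD _ DX)).
- exact: (leads_in_rowspace pivots_s (supD _ DX)).
move=> _ _ /imsetP[X DX ->] /imsetP[Y DY ->] neq.
apply: (dim_cap_same_pivots pivots_s (supD _ DX) (supD _ DY)).
by apply: rankD DX DY _; apply: contraNneq neq => ->.
Qed.

Lemma ferrers_echelon_code (s : seq nat) : (0 < k)%N -> pivots k n s ->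
  exists C, echelon_code s C /\
    (#|F| ^ (#|dots k n s| - maxn k #|free_cols n s|) <= #|C|)%N.
Proof.
move=> k_gt0 pivots_s.
have [D [supD rankD leD]] := ferrers_code F k_gt0 pivots_s.
have [||codeC cardC] := @echelon_code_of_matrices s [set X in D] pivots_s.
- by move=> X; rewrite inE; apply: supD.
- move=> X Y; rewrite !inE => DX DY neqXY.
  by apply: rankD; rewrite ?rpredB // subr_eq0.
exists [set rowspace (pivot_mx F k n s + X) | X in [set X in D]]; split=> //.
rewrite cardC card_set_vspace.
by rewrite leq_pexp2l // ltnW // finNzRing_gt1.
Qed.

(** * Lifted MRD codes as echelon codes *)

Hypothesis le_kn : (k <= n)%N.

Let ekn : (k + (n - k) = n)%N := subnKC le_kn.

Lemma pivots_iota : pivots k n (iota 0 k).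
Proof.
split; rewrite ?size_iota ?iota_ltn_sorted //.
by apply/allP=> c; rewrite mem_iota add0n => /leq_trans; apply.
Qed.

Definition pad_mx (A : 'M[F]_(k, n - k)) : 'M[F]_(k, n) :=
  castmx (erefl k, ekn) (row_mx 0 A).

Lemma pad_mxB A B : pad_mx A - pad_mx B = pad_mx (A - B).
Proof.
apply/matrixP=> i j; rewrite !(mxE, castmxE) /=.
by case: splitP => j' _; rewrite !mxE ?subr0.
Qed.

Lemma rank_castmx m1 n1 m2 n2 (e : (m1 = m2) * (n1 = n2)) (A : 'M[F]_(m1, n1)) :
  \rank (castmx e A) = \rank A.
Proof. by case: e => e1 e2; case: _ / e1; case: _ / e2; rewrite castmx_id. Qed.

Lemma rank_pad_mx A : (\rank A <= \rank (pad_mx A))%N.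
Proof.
rewrite rank_castmx.
have {1}-> : A = row_mx (0 : 'M_(k, k)) A *m col_mx 0 1%:M.
  by rewrite mul_row_col mulmx0 add0r mulmx1.
exact: mxrankM_maxl.
Qed.

Lemma lift_mxE A : lift_mx A = rowspace (pivot_mx F k n (iota 0 k) + pad_mx A).
Proof.
rewrite /lift_mx; congr rowspace.
rewrite -(conform_castmx (erefl k, ekn)) conform_mx_id.
apply/matrixP=> i j; rewrite !(mxE, castmxE) /= nth_iota // add0n.
case: splitP => j' /= Ej; rewrite Ej cast_ord_id.
  by rewrite !mxE addr0 eq_sym val_eqE.
by rewrite gtn_eqF ?add0r ?ltn_addr.
Qed.

Lemma lifted_echelon_code (D : {vspace 'M[F]_(k, n - k)}) : is_MRD 2 D ->
  echelon_code (iota 0 k) (lifted_code D) /\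
  #|lifted_code D| = (#|F| ^ (maxn k (n - k) * ((minn k (n - k)).+1 - 2)))%N.
Proof.
case/andP=> /eqP dimD /forallP rankD.
have rankB A B : A \in D -> B \in D -> A != B ->
    (1 < \rank (pad_mx A - pad_mx B)%R)%N.
  move=> DA DB neqAB; rewrite pad_mxB; apply: leq_trans (rank_pad_mx _).
  have /implyP/(_ _)/implyP := rankD (A - B); apply; first exact: rpredB.
  by rewrite subr_eq0.
have [||codeC cardC] := @echelon_code_of_matrices (iota 0 k)
    [set pad_mx A | A in [set A in D]] pivots_iota.
- move=> _ /imsetP[A _ ->] i j; rewrite inE /= nth_iota // mem_iota add0n /= => ij.
  rewrite castmxE mxE /=; case: splitP => j' /= Ej; rewrite ?mxE //.
  by case/negP: ij; rewrite Ej -leqNgt leq_addr ltn_addr.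
- move=> _ _ /imsetP[A DA ->] /imsetP[B DB ->] neq.
  rewrite !inE in DA DB; apply: rankB => //.
  by apply: contraNneq neq => ->.
have -> : lifted_code D
          = [set rowspace (pivot_mx F k n (iota 0 k) + X)
              | X in [set pad_mx A | A in [set A in D]]].
  rewrite -imset_comp; apply/setP=> U.
  apply/imsetP/imsetP=> -[A DA ->]; exists A; rewrite ?inE ?lift_mxE // in DA *.
split=> //; rewrite cardC card_in_imset ?card_set_vspace ?dimD // => A B.
rewrite !inE => DA DB eqAB; apply: contraTeq isT => /(rankB _ _ DA DB).
by rewrite eqAB subrr mxrank0.
Qed.

End EchelonCodes.

(** Leading coordinates bound the intersection of codewords from different pieces; the same bound
    excludes a common codeword, so the sizes add up. *)
Lemma bigcup_echelon_codes (F : finFieldType) (k n : nat) (I : finType)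
    (s : I -> seq nat) (C : I -> {set {vspace 'rV[F]_n}}) :
  (forall i, echelon_code k (s i) (C i)) ->
  (forall i i', i != i' -> (size [seq c <- s i | c \in s i'] + 2 <= k)%N) ->
  is_CDC 4 k (\bigcup_i C i) /\ #|\bigcup_i C i| = (\sum_i #|C i|)%N.
Proof.
move=> codeC sizeI.
have dimC i U : U \in C i -> \dim U = k by case: (codeC i) => dimC _ _ /dimC.
have dimI i i' U V : i != i' -> U \in C i -> V \in C i' ->
    (\dim (U :&: V)%VS + 2 <= k)%N.
  move=> neq Ui Vi'; apply: leq_trans (sizeI _ _ neq); rewrite leq_add2r.
  by apply: dim_cap_leads_in; [case: (codeC i) | case: (codeC i')] => _ + _; apply.
split.
  apply/andP; split.
    by apply/subsetP=> U /bigcupP[i _ /dimC]; rewrite inE => ->.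
  apply/forallP=> U; apply/implyP=> /bigcupP[i _ Ui].
  apply/forallP=> V; apply/implyP=> /bigcupP[i' _ Vi']; apply/implyP=> neqUV.
  rewrite /subspace_dist (dimC _ _ Ui) (dimC _ _ Vi').
  suff : (\dim (U :&: V)%VS + 2 <= k)%N by lia.
  have [eqii'|] := eqVneq i i'; last by move/dimI; apply.
  by subst i'; case: (codeC i) => _ _; apply.
apply/eqP; rewrite -sum1_card partition_disjoint_bigcup /=.
  by under [X in _ == X]eq_bigr => i _ do rewrite -sum1_card.
move=> i i' neq; rewrite -setI_eq0; apply/eqP/setP=> U; rewrite !inE.
apply/negP=> /andP[Ui Ui']; have := dimI _ _ _ _ neq Ui Ui'.
by rewrite capvv (dimC _ _ Ui); lia.
Qed.

(** * The code *)

Section FerrersSizes.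

Variables (k n : nat) (s : seq nat).
Hypothesis pivots_s : pivots k n s.

Definition dots_row (i : nat) : {set 'I_n} :=
  [set j : 'I_n | (nth 0%N s i < j)%N && (val j \notin s)].

Lemma card_dots : #|dots k n s| = (\sum_(i < k) #|dots_row i|)%N.
Proof.
rewrite -sum1_card (eq_bigr (fun i : 'I_k => \sum_(j in dots_row i) 1)%N).
  rewrite pair_big_dep /=; apply: eq_bigl => -[i j].
  by rewrite !inE.
by move=> i _; rewrite sum1_card.
Qed.

(** Of the [n - (nth 0 s i).+1] columns to the right of the [i]-th pivot, only the [k - i.+1] later
    pivots are lost. *)
Lemma card_dots_row (i : nat) : (i < k)%N ->
  (n - (nth 0%N s i).+1 - (k - i.+1) <= #|dots_row i|)%N.
Proof.
move=> lt_ik; have [ss srt _] := pivots_s.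
pose A := [set j : 'I_n | (nth 0%N s i < j)%N].
have cardA : #|A| = (n - (nth 0%N s i).+1)%N.
  rewrite -sum1_card (eq_bigl (fun j : 'I_n => (nth 0%N s i).+1 <= j)%N) => [|j].
    by rewrite -(big_geq_mkord _ _ xpredT (fun=> 1%N)) sum_nat_const_nat muln1.
  by rewrite inE.
pose B := [set j : 'I_n | val j \in s].
rewrite -cardA -(cardsID B A) leq_subLR.
have -> : A :\: B = dots_row i by apply/setP=> j; rewrite !inE andbC.
rewrite leq_add2r cardE -(size_map val) -ss -size_drop.
apply: uniq_leq_size; first by rewrite map_inj_uniq ?enum_uniq //; apply: val_inj.
move=> c /mapP[j]; rewrite mem_enum !inE => /andP[lt_j js] ->.
have lt_idx : (index (val j) s < size s)%N by rewrite index_mem.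
have lt_i : (i < index (val j) s)%N.
  rewrite ltnNge; apply: contraL lt_j => le_idx; rewrite -leqNgt.
  rewrite -[val j](nth_index 0%N js).
  have srt' : sorted leq s by move: srt; rewrite ltn_sorted_uniq_leq => /andP[].
  apply: (sorted_leq_nth leq_trans leqnn 0%N srt'); rewrite ?inE //.
  by rewrite ss.
rewrite -[val j](nth_index 0%N js) -(subnKC lt_i) -nth_drop mem_nth // size_drop.
by rewrite ltn_sub2r // (leq_ltn_trans lt_i).
Qed.

End FerrersSizes.

(* The first entry gives the lifted MRD code. The other entries are
   [0 :: e ++ f] with [e] an edge of the complete graph on {1, 2, 3, 4} and [f]
   an edge of the one on {5, 6, 7, 8}, lying in corresponding perfect matchings
   of two 1-factorizations; hence two of them share at most three columns. *)
Definition skeleton : seq (seq nat) :=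
  [:: [:: 0; 1; 2; 3; 4];
      [:: 0; 1; 2; 5; 6]; [:: 0; 1; 2; 7; 8]; [:: 0; 3; 4; 5; 6]; [:: 0; 3; 4; 7; 8];
      [:: 0; 1; 3; 5; 7]; [:: 0; 1; 3; 6; 8]; [:: 0; 2; 4; 5; 7]; [:: 0; 2; 4; 6; 8];
      [:: 0; 1; 4; 5; 8]; [:: 0; 1; 4; 6; 7]; [:: 0; 2; 3; 5; 8]; [:: 0; 2; 3; 6; 7]]%N.

Definition skel (t r : nat) : seq nat :=
  map (addn (5 * t)) (nth [::] skeleton r).

Lemma skel_common (t r t' r' : nat) : (r < 13)%N -> (r' < 13)%N ->
  (t, r) != (t', r') -> (size [seq c <- skel t r | c \in skel t' r'] + 2 <= 5)%N.
Proof.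
move=> lt_r lt_r'.
(* A later shift starts at least five columns further right, and at most three entries of each
   pattern are 5 or more. *)
have far a a' b b' : (b < 13)%N -> (b' < 13)%N -> (a < a')%N ->
    (size [seq c <- skel a b | c \in skel a' b'] <= 3)%N.
  move=> lt_b lt_b' lt_a; rewrite size_filter.
  have chk : all (fun x => count (leq 5) x <= 3)%N skeleton by [].
  apply: leq_trans (all_nthP [::] chk b lt_b).
  rewrite count_map -size_filter -[X in (_ <= X)%N]size_filter.
  rewrite !size_filter; apply: sub_count => c /mapP[d _]; lia.
have [-> neq|neqt _] := eqVneq t t'.
  have {}neq : r != r' by apply: contraNneq neq => ->.
  rewrite filter_map size_map (eq_filter (a2 := mem (nth [::] skeleton r'))).
    have /allP chk : all (fun x => all (fun y => (x == y) ||
        (size [seq c <- nth [::] skeleton x | c \in nth [::] skeleton y] + 2 <= 5)%N)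
        (iota 0 13)) (iota 0 13) by vm_compute.
    have [r13 r'13] : r \in iota 0 13 /\ r' \in iota 0 13 by rewrite !mem_iota.
    by have /allP/(_ r' r'13) := chk r r13; rewrite (negPf neq).
  by move=> c /=; rewrite mem_map //; apply: addnI.
rewrite -[5%N]/(3 + 2)%N leq_add2r.
case: (ltngtP t t') neqt => // lt_t _; first exact: far.
apply: leq_trans (far _ _ _ _ lt_r' lt_r lt_t); apply: uniq_leq_size.
  rewrite filter_uniq // map_inj_uniq; last exact: addnI.
  by have /(all_nthP [::])/(_ r lt_r) : all uniq skeleton by [].
by move=> c; rewrite !mem_filter andbC.
Qed.

Lemma skel_pivots (n t r : nat) : (r < 13)%N -> (5 * t + 9 <= n)%N ->
  pivots 5 n (skel t r).
Proof.
move=> lt_r le_n.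
have P (a : pred (seq nat)) : all a skeleton -> a (nth [::] skeleton r).
  by move=> /(all_nthP [::])/(_ r lt_r).
split; rewrite /skel.
- by rewrite size_map; apply/eqP; apply: (P (fun x => size x == 5)).
- apply: (homo_sorted (e := ltn)); last exact: (P (sorted ltn)).
  by move=> c d; rewrite /= ltn_add2l.
have /allP lt9 := P (all (fun c => c < 9)%N) isT.
by apply/allP=> _ /mapP[c /lt9 lt_c ->]; lia.
Qed.

(** The top row has at least [n - 5 t - 5 >= 7] dots, so the maximum is its size and cancels it. Row
    [i] among 1, ..., 4, with pattern entry [c_i], has at least [n - 5 t - c_i - 5 + i] dots, and
    [c_0 = 0]. *)
Lemma card_dots_skel (n t r : nat) : (r < 13)%N -> (5 * t + 12 <= n)%N ->
  (4 * (n - 5 * t) - 10 - sumn (nth [::] skeleton r)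
   <= #|dots 5 n (skel t r)| - maxn 5 #|free_cols n (skel t r)|)%N.
Proof.
move=> lt_r le_n.
have piv : pivots 5 n (skel t r) by apply: skel_pivots => //; lia.
rewrite card_dots big_ord_recl.
have -> : free_cols n (skel t r) = dots_row n (skel t r) 0 by [].
have row i lt_i := @card_dots_row 5 n (skel t r) piv i lt_i.
rewrite !big_ord_recl big_ord0 /=.
have := row 0%N isT; have := row 1%N isT; have := row 2%N isT.
have := row 3%N isT; have := row 4%N isT; rewrite /bump /=.
move: #|dots_row _ _ 0| #|dots_row _ _ 1| #|dots_row _ _ 2| => c0 c1 c2.
move: #|dots_row _ _ 3| #|dots_row _ _ 4| => c3 c4; clear row piv.
by do 13 (case: r lt_r => [|r] lt_r; first by rewrite /skel /=; lia).
Qed.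

(** Only two free columns may remain here: ten dots minus 5 still leave dimension 5. *)
Lemma card_dots_skel0 (n t : nat) : (5 * t + 7 <= n)%N -> pivots 5 n (skel t 0) ->
  (5 <= #|dots 5 n (skel t 0)| - maxn 5 #|free_cols n (skel t 0)|)%N.
Proof.
move=> le_n piv; rewrite card_dots big_ord_recl.
have -> : free_cols n (skel t 0) = dots_row n (skel t 0) 0 by [].
have row i lt_i := @card_dots_row 5 n (skel t 0) piv i lt_i.
rewrite !big_ord_recl big_ord0 /=.
have := row 0%N isT; have := row 1%N isT; have := row 2%N isT.
have := row 3%N isT; have := row 4%N isT; rewrite /bump /=.
move: #|dots_row _ _ 0| #|dots_row _ _ 1| #|dots_row _ _ 2| => c0 c1 c2.
by move: #|dots_row _ _ 3| #|dots_row _ _ 4| => c3 c4; lia.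
Qed.

Definition level_size (q m : nat) : nat :=
  (\sum_(r < 13) q ^ (4 * m - 10 - sumn (nth [::] skeleton r)))%N.

Lemma Abar_ge (F : finFieldType) (n : nat) : (12 <= n)%N ->
  (\sum_(t < ((n - 12) %/ 5).+1) level_size #|F| (n - 5 * t) + #|F| ^ 5
   <= Abar F n 4 5)%N.
Proof.
move=> le_n; set J := ((n - 12) %/ 5)%N.
have le_J : (5 * J + 12 <= n)%N by rewrite /J; lia.
have F_gt0 : (0 < #|F|)%N by apply: ltnW; apply: finNzRing_gt1.
(* The extra index is the pattern [{0, ..., 4}] at shift [J + 1], where at least seven columns
   remain. *)
pose I : finType := ('I_J.+1 * 'I_13 + unit)%type.
pose tr (i : I) : nat * nat :=
  match i with inl p => (val p.1, val p.2) | inr _ => (J.+1, 0%N) end.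
pose e (i : I) : nat := match i with
  inl p => (4 * (n - 5 * p.1) - 10 - sumn (nth [::] skeleton p.2))%N | inr _ => 5%N end.
have lt13 i : ((tr i).2 < 13)%N by case: i => [[? []]|[]].
have tr_inj : injective tr.
  move=> [[t r]|[]] [[t' r']|[]] //= [].
  - by move=> /val_inj-> /val_inj->.
  - by move=> Et; have := ltn_ord t; rewrite Et ltnn.
  by move=> Et; have := ltn_ord t'; rewrite -Et ltnn.
have pivI i : pivots 5 n (skel (tr i).1 (tr i).2).
  case: i => [[t r]|[]] /=.
    by apply: skel_pivots => //; have := ltn_ord t; lia.
  split=> //; first by rewrite /skel /= !ltn_add2l.
  by apply/allP => c /mapP[d]; rewrite !inE => + ->; lia.
have codeI i : exists C : {set {vspace 'rV[F]_n}},
    [/\ echelon_code 5 (skel (tr i).1 (tr i).2) C, (#|F| ^ e i <= #|C|)%N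
      & i = inl (ord0, ord0) -> contains_LMRD 5 2 C].
  (* Only the unshifted first pattern has to give a lifted MRD code; every other index receives a
     Ferrers code. *)
  have [Ei|nEi] := eqVneq i (inl (ord0, ord0)).
    have [D mrdD] := @MRD_exists F 5 (n - 5) isT.
    have le5n : (5 <= n)%N by lia.
    have [codeD cardD] := lifted_echelon_code le5n mrdD.
    exists (lifted_code D); rewrite Ei /=; split.
    - by rewrite /skel /=.
    - by rewrite cardD leq_pexp2l //; lia.
    by move=> _; apply/existsP; exists D; rewrite mrdD subxx.
  have [C [codeC cardC]] := ferrers_echelon_code F (isT : (0 < 5)%N) (pivI i).
  exists C; split=> // [|Ei]; last by rewrite Ei eqxx in nEi.
  apply: leq_trans cardC; rewrite leq_pexp2l //.
  case: i {nEi codeC} (pivI i) => [[t r]|[]] piv.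
    by apply: card_dots_skel => //=; have := ltn_ord t; lia.
  by apply: card_dots_skel0 => //=; lia.
have [C CP] := fin_all_exists codeI.
have [||cdcC cardC] := @bigcup_echelon_codes F 5 n I
    (fun i => skel (tr i).1 (tr i).2) C.
- by move=> i; case: (CP i).
- move=> i i' neq; apply: skel_common => //.
  by rewrite -!surjective_pairing (inj_eq tr_inj).
apply: (@leq_trans #|\bigcup_i C i|); last first.
  apply: (@leq_bigmax_cond _ _ (fun C : {set {vspace 'rV[F]_n}} => #|C|)).
  rewrite cdcC /=; case: (CP (inl (ord0, ord0))) => _ _ /(_ erefl).
  case/existsP=> D /andP[mrdD subD]; apply/existsP; exists D; rewrite mrdD /=.
  by apply: subset_trans subD _; apply: (bigcup_sup (inl (ord0, ord0))).
rewrite cardC big_sumType /=; apply: leq_add.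
  rewrite /level_size pair_bigA /=; apply: leq_sum => -[t r] _.
  by case: (CP (inl (t, r))).
by rewrite (bigD1 tt) //= (leq_trans _ (leq_addr _ _)) //; case: (CP (inr tt)).
Qed.

(** * Comparison with M *)

Lemma eq_ler (R : numDomainType) (a b : R) : a = b -> a <= b.
Proof. by move->. Qed.

(** The final polynomial inequality at [Q = 2], divided by [Q ^+ 15]: the right side is
    [112 + 5 / 8 - 44 * c - 48 * g], whence the hypothesis on [c] and [g]. *)
Lemma estimate_poly_2 (R : realFieldType) (c g : R) :
  0 <= c -> c <= 1 / 2 -> 0 <= g -> 44 * c + 48 * g <= 112 ->
  0 <= (6 - c - g) * 2 ^+ 5 - (g + 17 / 8) * 2 ^+ 4
       - (17 / 8 + c) * 2 ^+ 3 - 21 / 4 * 2 ^+ 2 - (17 / 8 + 2 * c) * 2 - 25 / 8.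
Proof. by move=> c0 c1 g0 cg; lra. Qed.

(* M is studied at x = y + 12: after factoring out powers of w = q ^ y, all
   exponents outside the two inner sums are natural numbers. *)
Section Estimates.

Variables (q y : nat).
Hypothesis q_ge2 : (2 <= q)%N.

Let Q : rat := q%:R.
Let w : rat := Q ^+ y.
Let r : rat := y%:R.
Let t : rat := Q ^ (-2).

Lemma Q_ge2 : 2 <= Q. Proof. by rewrite (ler_nat _ 2). Qed.
Lemma Q_gt0 : 0 < Q. Proof. by rewrite ltr0n; lia. Qed.
Lemma Q_neq0 : Q != 0. Proof. by rewrite gt_eqF ?Q_gt0. Qed.
Lemma w_gt0 : 0 < w. Proof. by rewrite exprn_gt0 ?Q_gt0. Qed.

Lemma natr1_le_expr (k : nat) : k%:R + 1 <= Q ^+ k.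
Proof.
by rewrite natr1 -natrX ler_nat ltn_expl.
Qed.

Lemma natr1_le_w : r + 1 <= w. Proof. exact: natr1_le_expr. Qed.

Lemma mulr_Q_le_w : (0 < y)%N -> r * Q <= w.
Proof.
move=> y_gt0; rewrite /w /r -(prednK y_gt0) exprSr ler_pM2r ?Q_gt0 //.
by rewrite -natr1 natr1_le_expr.
Qed.

Lemma expz_shift (a b : nat) (e : int) :
  e = (a * y + b)%N%:Z -> Q ^ e = w ^+ a * Q ^+ b.
Proof. by move=> ->; rewrite -exprnP exprD mulnC exprM. Qed.

Lemma expz_t (e : int) (i : nat) : Q ^ (e - 2 * i%:Z) = Q ^ e * t ^+ i.
Proof.
rewrite /t exprnP exprz_exp -expfzDr ?Q_neq0 //; congr (_ ^ _); lia.
Qed.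

Lemma expz_ge0 (e : int) : 0 <= Q ^ e.
Proof. by rewrite exprz_ge0 // ltW ?Q_gt0. Qed.

Lemma ler_expz (e f : int) : e <= f -> Q ^ e <= Q ^ f.
Proof. by move=> le_ef; apply: ler_weXz2l => //; apply: le_trans Q_ge2. Qed.

(** A model of the inner sums of M up to a power of [q]; the [1 / 8] leaves room for their
    lower-order terms. *)
Definition wsum (a b : nat) : rat := \sum_(a <= i < b) (i%:R + 1 / 8) * t ^+ i.

(** Since [t <= 1 / 9], the bound survives peeling off the first term: [a + 1 / 8 + (9 * a + 20) /
    72 <= (9 * a + 11) / 8]. *)
Lemma wsum_le (a b : nat) : (3 <= q)%N -> wsum a b <= (9 * a%:R + 11) / 8 * t ^+ a.
Proof.
move=> q_ge3; have t_ge0 : 0 <= t by apply: expz_ge0.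
have t_le : t <= 1 / 9.
  have Q_ge3 : 3 <= Q by rewrite (ler_nat _ 3).
  rewrite /t -[Q ^ _]/((Q ^+ 2)^-1) div1r lef_pV2 ?posrE ?exprn_gt0 ?Q_gt0 //.
  by rewrite expr2; nra.
have rhs_ge0 d : 0 <= (9 * d%:R + 11) / 8 * t ^+ d.
  apply: mulr_ge0; last exact: exprn_ge0.
  by have := ler0n rat d; lra.
have [le_ba|/ltnW le_ab] := leqP b a.
  by rewrite /wsum (big_geq le_ba); apply: rhs_ge0.
rewrite -(subnKC le_ab); move: (b - a)%N => d {le_ab}.
elim: d a => [|d IHd] a.
  by rewrite addn0 /wsum (big_geq (leqnn a)); apply: rhs_ge0.
have lt_a : (a < (a + d).+1)%N by rewrite ltnS leq_addr.
rewrite addnS /wsum (big_ltn lt_a) -addSn.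
apply: le_trans (lerD (lexx _) (IHd a.+1)) _.
rewrite exprS -(natr1 a); have := exprn_ge0 a t_ge0; have := ler0n rat a.
move: (t ^+ a) (a%:R) => T R R0 T0.
have : t * ((9 * R + 20) / 8 * T) <= 1 / 9 * ((9 * R + 20) / 8 * T).
  by apply: ler_wpM2r t_le; apply: mulr_ge0 T0; lra.
lra.
Qed.

(** [A], [B], [C] and [S1 + S2] stand for the second factors in M. Bounds of order [w ^+ 2] turn
    each product into a multiple of [w ^+ 4], leaving a polynomial inequality in [Q] alone. *)
Lemma estimate_combine (A B C S1 S2 c g d : rat) :
  A <= w ^+ 2 * (Q ^+ 10 + c * Q ^+ 6) ->
  B <= w ^+ 2 * (Q ^+ 9 + c * Q ^+ 5) ->
  C <= w ^+ 2 * (g * Q ^+ 8) ->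
  S1 + S2 <= w ^+ 2 * d ->
  (Q ^+ 14 + Q ^+ 10) * (Q ^+ 10 + c * Q ^+ 6)
  + (Q ^+ 13 + Q ^+ 11) * (Q ^+ 9 + c * Q ^+ 5)
  + (Q ^+ 12 + Q ^+ 11) * (g * Q ^+ 8) + (Q ^+ 12 + Q ^+ 10) * d
    <= Q ^+ 24 + Q ^+ 22 + 8 * Q ^+ 20 + Q ^+ 18 + Q ^+ 16 ->
  w ^+ 4 * Q ^+ 28 + (w ^+ 2 * Q ^+ 14 + w ^+ 2 * Q ^+ 10) * A
  + (w ^+ 2 * Q ^+ 13 + w ^+ 2 * Q ^+ 11) * B
  + (w ^+ 2 * Q ^+ 12 + w ^+ 2 * Q ^+ 11) * C
  + (w ^+ 2 * Q ^+ 12 + w ^+ 2 * Q ^+ 10) * (S1 + S2)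
    <= w ^+ 4 * (Q ^+ 28 + Q ^+ 24 + Q ^+ 22 + 8 * Q ^+ 20 + Q ^+ 18 + Q ^+ 16).
Proof.
have Qp k : 0 <= w ^+ 2 * Q ^+ k.
  by rewrite mulr_ge0 ?exprn_ge0 // ltW ?w_gt0 ?Q_gt0.
move=> hA hB hC hS poly.
apply: (@le_trans _ _ (w ^+ 4 * (Q ^+ 28 +
  ((Q ^+ 14 + Q ^+ 10) * (Q ^+ 10 + c * Q ^+ 6)
  + (Q ^+ 13 + Q ^+ 11) * (Q ^+ 9 + c * Q ^+ 5)
  + (Q ^+ 12 + Q ^+ 11) * (g * Q ^+ 8) + (Q ^+ 12 + Q ^+ 10) * d)))); last first.
  by rewrite ler_wpM2l ?exprn_ge0 // ?(ltW w_gt0) // -!addrA lerD2l !addrA.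
have {}hA := ler_wpM2l (addr_ge0 (Qp 14%N) (Qp 10%N)) hA.
have {}hB := ler_wpM2l (addr_ge0 (Qp 13%N) (Qp 11%N)) hB.
have {}hC := ler_wpM2l (addr_ge0 (Qp 12%N) (Qp 11%N)) hC.
have {}hS := ler_wpM2l (addr_ge0 (Qp 12%N) (Qp 10%N)) hS.
apply: le_trans (lerD (lerD (lerD (lerD (lexx _) hA) hB) hC) hS) _.
by apply: eq_ler; ring.
Qed.

Lemma estimate_poly_ge3 (c g : rat) : (3 <= q)%N -> 0 <= c -> c <= 1 / 2 ->
  0 <= g -> 44 * c + 48 * g <= 112 ->
  (Q ^+ 14 + Q ^+ 10) * (Q ^+ 10 + c * Q ^+ 6)
  + (Q ^+ 13 + Q ^+ 11) * (Q ^+ 9 + c * Q ^+ 5)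
  + (Q ^+ 12 + Q ^+ 11) * (g * Q ^+ 8)
  + (Q ^+ 12 + Q ^+ 10) * (19 / 4 * Q ^+ 6 + 29 / 8 * Q ^+ 7)
    <= Q ^+ 24 + Q ^+ 22 + 8 * Q ^+ 20 + Q ^+ 18 + Q ^+ 16.
Proof.
move=> q_ge3 c0 c1 g0 cg.
have Q_ge3 : 3 <= Q by rewrite (ler_nat _ 3).
rewrite -subr_ge0.
have -> : Q ^+ 24 + Q ^+ 22 + 8 * Q ^+ 20 + Q ^+ 18 + Q ^+ 16 -
  ((Q ^+ 14 + Q ^+ 10) * (Q ^+ 10 + c * Q ^+ 6) +
   (Q ^+ 13 + Q ^+ 11) * (Q ^+ 9 + c * Q ^+ 5) +
   (Q ^+ 12 + Q ^+ 11) * (g * Q ^+ 8) +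
   (Q ^+ 12 + Q ^+ 10) * (19 / 4 * Q ^+ 6 + 29 / 8 * Q ^+ 7)) =
  Q ^+ 16 * ((6 - c - g) * Q ^+ 4 - (g + 29 / 8) * Q ^+ 3
             - (15 / 4 + c) * Q ^+ 2 - 29 / 8 * Q - (15 / 4 + 2 * c)) by field.
apply: mulr_ge0; first by apply: exprn_ge0; apply: ltW Q_gt0.
have Q2 : 3 * Q <= Q ^+ 2 by rewrite expr2; nra.
have Q3 : 3 * Q ^+ 2 <= Q ^+ 3 by rewrite exprS; nra.
have Q4 : 3 * Q ^+ 3 <= Q ^+ 4 by rewrite (exprS _ 3); nra.
have Q3_ge0 : 0 <= Q ^+ 3 by lra.
(* The hypotheses give [g <= 7 / 3] and [c + g <= 19 / 8]; the coefficients are rounded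
   accordingly. *)
have : 34 / 10 * Q ^+ 4 <= (6 - c - g) * Q ^+ 4 by rewrite ler_wpM2r; lra.
have : (g + 29 / 8) * Q ^+ 3 <= 60 / 10 * Q ^+ 3 by rewrite ler_wpM2r; lra.
have : (15 / 4 + c) * Q ^+ 2 <= 17 / 4 * Q ^+ 2 by rewrite ler_wpM2r; lra.
lra.
Qed.

End Estimates.

(** * Upper bounds for M at even and odd arguments *)

Section TermBounds.

Variables (q y : nat).
Hypothesis q_ge2 : (2 <= q)%N.

Let Q : rat := q%:R.
Let w : rat := Q ^+ y.
Let r : rat := y%:R.
Let X : int := (y + 12)%N%:Z.

(* For q = 2 the inner sums have exactly one and two terms, and the geometric
   bound used for q >= 3 would be too weak. *)
Definition wsum_cap : rat := if q == 2
  then 17 / 8 * Q ^+ 7 + 25 / 8 * Q ^+ 6 + 25 / 8 * Q ^+ 5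
  else 19 / 4 * Q ^+ 6 + 29 / 8 * Q ^+ 7.

Lemma wsums_le :
  Q ^+ 12 * wsum q 3 (minn (uphalf q + 2) (y + 12 - 5)./2).+1
  + Q ^+ 11 * wsum q 2 (minn (q./2 + 2) (uphalf (y + 12 - 7))).+1 <= wsum_cap.
Proof.
have Qp k : 0 <= Q ^+ k by rewrite exprn_ge0 // (ltW (Q_gt0 q_ge2)).
have E (c : rat) (m k a : nat) : m = (k + 2 * a)%N ->
    Q ^+ m * (c * (Q ^ (- 2)) ^+ a) = c * Q ^+ k.
  move=> ->; rewrite mulrCA; congr (_ * _).
  rewrite exprD -mulrA exprM -exprMn -[Q ^ (-2)]/((Q ^+ 2)^-1).
  by rewrite divff ?expr1n ?mulr1 // expf_neq0 // Q_neq0.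
rewrite /wsum_cap; case: eqP => [q2|q_neq2].
  have -> : minn (uphalf q + 2) (y + 12 - 5)./2 = 3%N by rewrite q2 /=; lia.
  have -> : minn (q./2 + 2) (uphalf (y + 12 - 7)) = 3%N by rewrite q2 /=; lia.
  rewrite /wsum big_nat1 (big_ltn (isT : (2 < 4)%N)) big_nat1 mulrDr.
  by rewrite (E _ 12 6 3 erefl)%N (E _ 11 7 2 erefl)%N (E _ 11 5 3 erefl)%N; lra.
have q_ge3 : (3 <= q)%N by lia.
apply: le_trans (lerD (ler_wpM2l (Qp _) (wsum_le q_ge2 _ _ q_ge3))
                      (ler_wpM2l (Qp _) (wsum_le q_ge2 _ _ q_ge3))) _.
by rewrite (E _ 12 6 3 erefl)%N (E _ 11 7 2 erefl)%N; lra.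
Qed.

(** Each summand may exceed its leading part, [i] times a power of [Q], by an eighth of that
    power. *)
Lemma sums_le (f1 f2 : nat -> rat) :
  (forall i, (3 <= i)%N -> (i <= (y + 12 - 5)./2)%N ->
     f1 i <= (i%:R + 1 / 8) * Q ^ (2 * X - 2 * i%:Z - 12)) ->
  (forall i, (2 <= i)%N -> (i <= uphalf (y + 12 - 7))%N ->
     f2 i <= (i%:R + 1 / 8) * Q ^ (2 * X - 2 * i%:Z - 13)) ->
  \sum_(3 <= i < (minn (uphalf q + 2) (y + 12 - 5)./2).+1) f1 i
  + \sum_(2 <= i < (minn (q./2 + 2) (uphalf (y + 12 - 7))).+1) f2 i
  <= w ^+ 2 * wsum_cap.
Proof.
move=> le1 le2.
have shift (k l i : nat) : (k + l = 24)%N ->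
    Q ^ (2 * X - 2 * i%:Z - k%:Z) = w ^+ 2 * (Q ^+ l * (Q ^ (- 2)) ^+ i).
  move=> kl; rewrite mulrA -(@expz_shift q y 2 l (2 * X - k%:Z)).
    by rewrite -expz_t //; congr (_ ^ _); lia.
  by rewrite /X; lia.
apply: le_trans (ler_wpM2l _ wsums_le); last by rewrite exprn_ge0 // ltW // w_gt0.
rewrite mulrDr /wsum !mulr_sumr; apply: lerD; apply: ler_sum_nat => i /andP[i1 i2].
  apply: le_trans (le1 i i1 _) _; first by lia.
  by apply: eq_ler; rewrite -[12]/(12%N%:Z) (@shift 12 12)%N //; ring.
apply: le_trans (le2 i i1 _) _; first by lia.
by apply: eq_ler; rewrite -[13]/(13%N%:Z) (@shift 13 11)%N //; ring.
Qed.

Lemma poly_le (c g : rat) :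
  0 <= c -> c <= 1 / 2 -> 0 <= g -> 44 * c + 48 * g <= 112 ->
  (Q ^+ 14 + Q ^+ 10) * (Q ^+ 10 + c * Q ^+ 6)
  + (Q ^+ 13 + Q ^+ 11) * (Q ^+ 9 + c * Q ^+ 5)
  + (Q ^+ 12 + Q ^+ 11) * (g * Q ^+ 8) + (Q ^+ 12 + Q ^+ 10) * wsum_cap
    <= Q ^+ 24 + Q ^+ 22 + 8 * Q ^+ 20 + Q ^+ 18 + Q ^+ 16.
Proof.
move=> c0 c1 g0 cg; rewrite /wsum_cap; case: eqP => [q2|q_neq2].
  rewrite -subr_ge0.
  have -> : Q ^+ 24 + Q ^+ 22 + 8 * Q ^+ 20 + Q ^+ 18 + Q ^+ 16 -
    ((Q ^+ 14 + Q ^+ 10) * (Q ^+ 10 + c * Q ^+ 6) +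
     (Q ^+ 13 + Q ^+ 11) * (Q ^+ 9 + c * Q ^+ 5) +
     (Q ^+ 12 + Q ^+ 11) * (g * Q ^+ 8) +
     (Q ^+ 12 + Q ^+ 10) *
       (17 / 8 * Q ^+ 7 + 25 / 8 * Q ^+ 6 + 25 / 8 * Q ^+ 5)) =
    Q ^+ 15 * ((6 - c - g) * Q ^+ 5 - (g + 17 / 8) * Q ^+ 4
               - (17 / 8 + c) * Q ^+ 3 - 21 / 4 * Q ^+ 2
               - (17 / 8 + 2 * c) * Q - 25 / 8) by field.
  apply: mulr_ge0; first by apply: exprn_ge0; apply: ltW (Q_gt0 q_ge2).
  have -> : Q = 2 by rewrite /Q q2.
  exact: estimate_poly_2.
have q_ge3 : (3 <= q)%N by lia.
exact: estimate_poly_ge3.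
Qed.

Lemma Q3_ge8 : 8 <= Q ^+ 3.
Proof.
by rewrite (_ : 8 = 2 ^+ 3) // lerXn2r ?nnegrE ?(Q_ge2 q_ge2) // (ltW (Q_gt0 q_ge2)).
Qed.

Lemma M_even_le :
  M_even q (y + 12) <= w ^+ 4 *
    (Q ^+ 28 + Q ^+ 24 + Q ^+ 22 + 8 * Q ^+ 20 + Q ^+ 18 + Q ^+ 16).
Proof.
have Q0 := Q_gt0 q_ge2; have Qn0 : Q != 0 := Q_neq0 q_ge2.
have w0 := w_gt0 y q_ge2.
have r0 : 0 <= r := ler0n _ _; have wr : r + 1 <= w := natr1_le_w y q_ge2.
have wQ0 k : 0 <= w * Q ^+ k by rewrite mulr_ge0 ?exprn_ge0 ?ltW.
have Q3 := Q3_ge8.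
have wQ3 : 8 * (r + 1) <= w * Q ^+ 3 by nra.
have wQ7 : 128 * (r + 1) <= w * Q ^+ 7.
  rewrite (_ : w * Q ^+ 7 = w * Q ^+ 3 * Q ^+ 4); last by ring.
  have Q4 : 16 <= Q ^+ 4 by have := Q_ge2 q_ge2; rewrite (exprS _ 3) -/Q; nra.
  by nra.
have rE : (y + 12)%N%:R = r + 12 :> rat by rewrite natrD.
(* [c = 1 / 4] absorbs the terms with coefficient [(x - 8) / 2]; [g = 2 + 1 / 16] combines the
   leading coefficient 2 of the third factor with room for the term in [(x - 10) / 2]. *)
have [c0 c1 g0 cg] : [/\ 0 <= 1 / 4 :> rat, 1 / 4 <= 1 / 2 :> rat, 0 <= 33 / 16 :> rat
    & 44 * (1 / 4) + 48 * (33 / 16) <= 112 :> rat] by split; lra.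
have poly := poly_le c0 c1 g0 cg; clear c0 c1 g0 cg.
have kA : (r + 12 - 8) / 2 <= w * Q ^+ 3 / 4 by lra.
have kC : (r + 12 - 10) / 2 <= w * Q ^+ 7 / 16 by lra.
have kD (i : rat) : 2 <= i -> (r + 12 - 6) / 2 - i <= w * Q ^+ 7 / 8 by lra.
rewrite /M_even; cbv zeta; rewrite rE -/X -/Q; have EX : X = (y + 12)%N%:Z by [].
have := sums_le; move: EX; move: (X) => x xE sums_le.
rewrite (@expz_shift q y 4 28 (4 * (x - 5))); last by clear -xE; lia.
rewrite (@expz_shift q y 2 14 (2 * x - 10)); last by clear -xE; lia.
rewrite (@expz_shift q y 2 10 (2 * x - 14)); last by clear -xE; lia.
rewrite (@expz_shift q y 1 3 (x - 9)); last by clear -xE; lia.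
rewrite (@expz_shift q y 2 13 (2 * x - 11)); last by clear -xE; lia.
rewrite (@expz_shift q y 2 11 (2 * x - 13)); last by clear -xE; lia.
rewrite (@expz_shift q y 1 2 (x - 10)); last by clear -xE; lia.
rewrite (@expz_shift q y 2 9 (2 * x - 15)); last by clear -xE; lia.
rewrite (@expz_shift q y 2 12 (2 * x - 12)); last by clear -xE; lia.
rewrite (@expz_shift q y 2 8 (2 * x - 16)); last by clear -xE; lia.
rewrite (@expz_shift q y 1 1 (x - 11)); last by clear -xE; lia.
rewrite -/Q -/w; apply: (estimate_combine _ _ _ _ poly).
- rewrite -/Q -/w mulrDr lerD2l expr1.
  rewrite (_ : w ^+ 2 * _ = w * Q ^+ 3 / 4 * (w * Q ^+ 3)); last by field.
  exact: ler_wpM2r kA.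
- rewrite -/Q -/w mulrDr addrC lerD2l expr1.
  rewrite (_ : w ^+ 2 * _ = w * Q ^+ 3 / 4 * (w * Q ^+ 2)); last by field.
  exact: ler_wpM2r kA.
- rewrite expr1 -/Q -/w [X in _ <= X](_ : _ =
    2 * (w ^+ 2 * Q ^+ 8) + w * Q ^+ 7 / 16 * (w * Q ^+ 1)); last by field.
  by rewrite lerD2l; apply: ler_wpM2r kC.
(* In both sums the two exponents differ by [x - 5], and an eighth of [Q ^ (x - 5) = w * Q ^+ 7]
   dominates the linear coefficient. *)
have tailE (i : nat) (e f : int) : (2 <= i)%N -> e = f + (x - 5) ->
    i%:R * Q ^ e + ((r + 12 - 6) / 2 - i%:R) * Q ^ f <= (i%:R + 1 / 8) * Q ^ e.
  move=> i2 ->; rewrite (expfzDr _ _ Qn0).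
  rewrite (@expz_shift q y 1 7 (x - 5)); last by clear -xE; lia.
  rewrite -/Q -/w expr1 [(i%:R + _) * _]mulrDl lerD2l.
  rewrite (_ : 1 / 8 * _ = w * Q ^+ 7 / 8 * Q ^ f); last by field.
  apply: ler_wpM2r; first exact: expz_ge0.
  by apply: kD; rewrite (ler_nat _ 2).
apply: sums_le => i i2 _.
  by apply: (tailE i _ _ (ltnW i2)); clear; lia.
by apply: (tailE i _ _ i2); clear; lia.
Qed.

Lemma M_odd_le : odd y ->
  M_odd q (y + 12) <= w ^+ 4 *
    (Q ^+ 28 + Q ^+ 24 + Q ^+ 22 + 8 * Q ^+ 20 + Q ^+ 18 + Q ^+ 16).
Proof.
move=> odd_y; have y0 : (0 < y)%N by case: (y) odd_y.
have Q0 := Q_gt0 q_ge2; have Qn0 : Q != 0 := Q_neq0 q_ge2.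
have w0 := w_gt0 y q_ge2; have Q2 : 2 <= Q := Q_ge2 q_ge2.
have r1 : 1 <= r by rewrite (ler_nat _ 1).
have wr : r + 1 <= w := natr1_le_w y q_ge2.
have wrQ : r * Q <= w := mulr_Q_le_w q_ge2 y0.
have wQ0 k : 0 <= w * Q ^+ k by rewrite mulr_ge0 ?exprn_ge0 ?ltW.
have Q3 := Q3_ge8.
have Q22 : 4 <= Q ^+ 2 by rewrite expr2; nra.
have Q33 : 4 * Q <= Q ^+ 3 by rewrite exprS; nra.
have Q5 : 4 * Q ^+ 3 <= Q ^+ 5 by rewrite (exprD _ 2 3); nra.
have Q6 : 8 * Q ^+ 3 <= Q ^+ 6 by rewrite (exprD _ 3 3); nra.
have wQ2 : 4 * (r + 1) <= w * Q ^+ 2 by nra.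
have wQ6 : 64 * (r + 1) <= w * Q ^+ 6 by nra.
have wQ6' : 16 * (w * Q ^+ 2) <= w * Q ^+ 6.
  rewrite (_ : w * Q ^+ 6 = Q ^+ 2 * (Q ^+ 2 * (w * Q ^+ 2))); last by ring.
  by have := wQ0 2%N; nra.
have rE : (y + 12)%N%:R = r + 12 :> rat by rewrite natrD.
have [c0 c1 g0 cg] : [/\ 0 <= 1 / 2 :> rat, 1 / 2 <= 1 / 2 :> rat, 0 <= 3 / 2 :> rat
    & 44 * (1 / 2) + 48 * (3 / 2) <= 112 :> rat] by split; lra.
have poly := poly_le c0 c1 g0 cg; clear c0 c1 g0 cg.
have kA : 0 <= (w * Q ^+ 5 - (r + 3) * Q ^+ 3 - 2) / 2.
  suff : (r + 1) * (4 * Q ^+ 3) <= w * Q ^+ 5 by nra.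
  have a : 0 <= r + 1 by lra.
  have b : 0 <= 4 * Q ^+ 3 by lra.
  exact: ler_pM a b wr Q5.
(* An equality for [Q = 2] and [y = 1], so [c = 1 / 2] has no slack here; [r * Q <= w] relies on
   [y > 0]. *)
have kB : (r + 3) / 2 + Q <= w * Q ^+ 2 / 2.
  suff : (r * Q) * 4 <= w * Q ^+ 2 by nra.
  have a : 0 <= r * Q by nra.
  exact: ler_pM a (ler0n _ 4) wrQ Q22.
have kC : 0 <= (w * Q ^+ 6 * Q ^+ 2 - (r + 1) * Q ^+ 2 - 2) / 2 by nra.
have kD1 (i : rat) : 3 <= i -> 0 <= w * Q ^+ 6 / 8 - ((r + 12 - 7) / 2 - i) - 1.
  by lra.
have kD2 (i u : rat) : 2 <= i -> u <= w * Q ^+ 2 ->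
    0 <= w * Q ^+ 6 / 8 - ((r + 12 - 7) / 2 - i) - u by lra.
have wexp (e : int) (b : nat) : e <= (y + b)%N%:Z -> Q ^ e <= w * Q ^+ b.
  by move=> le_e; rewrite -exprD exprnP; apply: ler_expz.
rewrite /M_odd; cbv zeta; rewrite rE -/X -/Q; have EX : X = (y + 12)%N%:Z by [].
have := sums_le; move: EX; move: (X) => x xE sums_le.
rewrite (@expz_shift q y 4 28 (4 * (x - 5))); last by clear -xE; lia.
rewrite (@expz_shift q y 2 14 (2 * x - 10)); last by clear -xE; lia.
rewrite (@expz_shift q y 2 10 (2 * x - 14)); last by clear -xE; lia.
rewrite (@expz_shift q y 1 4 (x - 8)); last by clear -xE; lia.
rewrite (@expz_shift q y 2 13 (2 * x - 11)); last by clear -xE; lia.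
rewrite (@expz_shift q y 2 11 (2 * x - 13)); last by clear -xE; lia.
rewrite (@expz_shift q y 1 3 (x - 9)); last by clear -xE; lia.
rewrite (@expz_shift q y 2 9 (2 * x - 15)); last by clear -xE; lia.
rewrite (@expz_shift q y 2 12 (2 * x - 12)); last by clear -xE; lia.
rewrite (@expz_shift q y 2 8 (2 * x - 16)); last by clear -xE; lia.
rewrite (@expz_shift q y 1 2 (x - 10)); last by clear -xE; lia.
rewrite -/Q -/w !expr1; apply: (estimate_combine _ _ _ _ poly).
- rewrite -/Q -/w mulrDr -addrA lerD2l.
  have h1 : Q ^ ((x - 9) %/ 2)%Z <= w * Q ^+ 1 by apply: wexp; clear -xE y0; lia.
  apply: le_trans (lerD (lexx _) h1) _.
  rewrite -subr_ge0 (_ : _ - _ =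
    w * Q * ((w * Q ^+ 5 - (r + 3) * Q ^+ 3 - 2) / 2)); last by field.
  exact: mulr_ge0 (mulr_ge0 (ltW w0) (ltW Q0)) kA.
- rewrite -/Q -/w mulrDr [X in X <= _](_ : _ =
    w ^+ 2 * Q ^+ 9 + ((r + 3) / 2 + Q) * (w * Q ^+ 3)); last by field.
  rewrite lerD2l (_ : w ^+ 2 * _ = w * Q ^+ 2 / 2 * (w * Q ^+ 3)); last by field.
  exact: ler_wpM2r kB.
- rewrite -/Q -/w.
  have h1 : Q ^ ((x - 11) %/ 2)%Z <= w * Q ^+ 0 by apply: wexp; clear -xE y0; lia.
  apply: le_trans (lerD (lexx _) h1) _.
  rewrite -subr_ge0 (_ : _ - _ =
    w * ((w * Q ^+ 6 * Q ^+ 2 - (r + 1) * Q ^+ 2 - 2) / 2)); last by field.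
  exact: mulr_ge0 (ltW w0) kC.
apply: sums_le => i i_ge i_le.
  rewrite [2 * x - _ - _](_ : _ = (x - 2 * i%:Z - 6) + (x - 6)); last by clear; lia.
  rewrite (expfzDr _ _ Qn0) (@expz_shift q y 1 6 (x - 6)); last by clear -xE; lia.
  rewrite -/Q -/w expr1.
  (* For odd [x] the exponents compare exactly when [i <= (x - 5) / 2], an upper limit of the
     sum. *)
  have h1 : Q ^ (((x - 7) %/ 2)%Z - i%:Z) <= Q ^ (x - 2 * i%:Z - 6).
    by apply: (ler_expz q_ge2); clear -xE i_le; lia.
  apply: le_trans (lerD (lexx _) h1) _.
  have i3 : 3 <= i%:R :> rat by rewrite (ler_nat _ 3).
  rewrite -subr_ge0 (_ : _ - _ = Q ^ (x - 2 * i%:Z - 6) *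
     (w * Q ^+ 6 / 8 - ((r + 12 - 7) / 2 - i%:R) - 1)); last by field.
  by apply: mulr_ge0; [apply: expz_ge0 | apply: kD1].
rewrite [2 * x - _ - _](_ : _ = (x - 2 * i%:Z - 7) + (x - 6)); last by clear; lia.
rewrite [x - i%:Z - 7](_ : _ = (x - 2 * i%:Z - 7) + i%:Z); last by clear; lia.
rewrite (expfzDr (x - 2 * i%:Z - 7) (x - 6) Qn0).
rewrite (expfzDr (x - 2 * i%:Z - 7) i%:Z Qn0).
rewrite (@expz_shift q y 1 6 (x - 6)); last by clear -xE; lia.
rewrite -/Q -/w expr1.
(* [i <= uphalf (y + 5)], which is at most [y + 2] because [y >= 1]. *)
have h1 : Q ^ i%:Z <= w * Q ^+ 2 by apply: wexp; clear -y0 i_le; lia.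
have i2 : 2 <= i%:R :> rat by rewrite (ler_nat _ 2).
rewrite -subr_ge0 (_ : _ - _ = Q ^ (x - 2 * i%:Z - 7) *
   (w * Q ^+ 6 / 8 - ((r + 12 - 7) / 2 - i%:R) - Q ^ i%:Z)); last by field.
by apply: mulr_ge0; [apply: expz_ge0 | apply: kD2].
Qed.

End TermBounds.

(** The common bound of the even and odd cases is exactly [level_size] at [x = y + 12]. *)
Lemma M_term_le (q x : nat) : (2 <= q)%N -> (12 <= x)%N ->
  M_term q x <= (level_size q x)%:R.
Proof.
move=> q_ge2 x_ge12; rewrite -(subnK x_ge12); move: (x - 12)%N => y.
apply: (@le_trans _ _ ((q%:R ^+ y) ^+ 4 * (q%:R ^+ 28 + q%:R ^+ 24 + q%:R ^+ 22
                       + 8 * q%:R ^+ 20 + q%:R ^+ 18 + q%:R ^+ 16))).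
  rewrite /M_term oddD addbF; case: ifP => [/M_odd_le|_]; first exact.
  exact: M_even_le.
(* Each entry is 38 minus the sum of the corresponding pattern, as
   [4 * (y + 12) - 10 = 4 * y + 38]. *)
pose e := [:: 28; 24; 20; 20; 16; 22; 20; 20; 18; 20; 20; 20; 20]%N.
have E (i : 'I_13) : (q ^ (4 * (y + 12) - 10 - sumn (nth [::] skeleton i)))%:R
    = (q%:R ^+ y) ^+ 4 * q%:R ^+ nth 0%N e i :> rat.
  rewrite natrX -exprM -exprD; congr (_ ^+ _).
  case: i => r lt_r /=.
  by do 13 (case: r lt_r => [|r] lt_r; first by rewrite /=; clear; lia).
rewrite /level_size natr_sum (eq_bigr _ (fun i _ => E i)) -mulr_sumr.
rewrite !big_ord_recl big_ord0 /bump /=; apply: eq_ler; ring.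
Qed.

Theorem theorem3p16 (F : finFieldType) (q n : nat)
    (hq : #|F| = q) (hn : (12 <= n)%N) :
  M_1 q n + q%:R ^+ 4 + q%:R ^+ 3 + q%:R ^+ 2 + q%:R + 1
    <= (Abar F n 4 5)%:R.
Proof.
have q_ge2 : (2 <= q)%N by rewrite -hq finNzRing_gt1.
apply: (@le_trans _ _ (\sum_(t < ((n - 12) %/ 5).+1) level_size q (n - 5 * t)
                       + q ^ 5)%:R); last first.
  by rewrite ler_nat -hq Abar_ge.
(* The [q ^ 5] codewords of the last shift exceed the geometric sum [(q ^ 5 - 1) / (q - 1)]. *)
have tail_le : q%:R ^+ 4 + q%:R ^+ 3 + q%:R ^+ 2 + q%:R + 1 <= (q ^ 5)%:R :> rat.
  have Q_ge2 : 2 <= q%:R :> rat by rewrite (ler_nat _ 2).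
  have geo : (q%:R - 1) * (q%:R ^+ 4 + q%:R ^+ 3 + q%:R ^+ 2 + q%:R + 1)
             = q%:R ^+ 5 - 1 :> rat by ring.
  have pos : 0 <= q%:R ^+ 4 + q%:R ^+ 3 + q%:R ^+ 2 + q%:R + 1 :> rat.
    by rewrite !addr_ge0 ?exprn_ge0.
  by rewrite natrX; nra.
rewrite natrD -!addrA; apply: lerD; last by move: tail_le; rewrite -!addrA.
rewrite /M_1 big_mkord natr_sum; apply: ler_sum => t _.
by apply: M_term_le => //; have := ltn_ord t; lia.
Qed.
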